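(* Let $p$ be a prime and let $k,n$ be nonnegative integers such that $p\nmid 3n+2$. (1) If $p\equiv 1 \pmod 3$, then \[A_{3}\Big(p^kn+\frac{2p^{k}-2}{3}\Big)=\frac{p^{k+1}-1}{p-1}A_{3}(n).\] (2) If $p\equiv 2 \pmod 3$, then \[A_{3}\Big(p^{2k}n+\frac{2p^{2k}-2}{3}\Big)=\frac{p^{2k+1}-1}{p-1}A_{3}(n).\]
   Context: A partition $\lambda$ of a nonnegative integer is called a $3$-core if none of its hook lengths is divisible by $3$. $A_3(n)$ denotes the number of ordered pairs $(\lambda_1,\lambda_2)$ of partitions, each a $3$-core, whose sizes sum to $n$; equivalently $\sum_{n\ge0}A_3(n)q^n=\frac{(q^3;q^3)_\infty^{6}}{(q;q)_\infty^{2}}$, where $(a;q)_\infty=\prod_{k\ge0}(1-aq^k)$. *)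

(* Defs.v *)
From mathcomp Require Import all_boot.
Set Implicit Arguments. Unset Strict Implicit. Unset Printing Implicit Defensive.

(* A partition is represented as a nonincreasing sequence of naturals,
   possibly padded with trailing zeros (zero parts are ignored). *)
Definition is_partition (s : seq nat) : bool := sorted geq s.

Definition conj_part (s : seq nat) (j : nat) : nat := count (fun x => j < x) s.

(* Hook length of the cell (i, j) (0-indexed, j < lambda_i):
   arm + leg + 1 = (lambda_i - j - 1) + (lambda'_j - i - 1) + 1. *)
Definition hook (s : seq nat) (i j : nat) : nat :=
  (nth 0 s i - j) + (conj_part s j - i) - 1.

Definition is_core (t : nat) (s : seq nat) : bool :=
  is_partition s &&
  all (fun i => all (fun j => ~~ (t %| hook s i j)) (iota 0 (nth 0 s i)))
      (iota 0 (size s)).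

(* A_3(n): number of ordered pairs (lambda1, lambda2) of 3-cores with
   |lambda1| + |lambda2| = n.  Every partition of m <= n has at most n parts,
   each at most n, so it is represented uniquely by its zero-padding to an
   n-tuple with entries in 'I_n.+1. *)
Definition A3 (n : nat) : nat :=
  #|[set x : (n.-tuple 'I_n.+1) * (n.-tuple 'I_n.+1) |
      let s1 := map (@nat_of_ord _) (val x.1) in
      let s2 := map (@nat_of_ord _) (val x.2) in
      [&& is_core 3 s1, is_core 3 s2 & sumn s1 + sumn s2 == n]]|.

(* Main.v *)
Require Import Defs.
From mathcomp Require Import all_boot.
From mathcomp Require Import order ssralg ssrnum ssrint intdiv poly zmodp cyclic.
From mathcomp Require Import zify ring.
Set Implicit Arguments. Unset Strict Implicit. Unset Printing Implicit Defensive.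
Import Order.TTheory GRing.Theory Num.Theory.

(* The point is that 3 A_3(n) = sigma(3n + 2); multiplicativity of sigma then gives both
   claims at once, since 3 (p^k n + (2 p^k - 2)/3) + 2 = p^k (3n + 2).

   The 3-cores of i correspond, through their bead sets on a 3-runner abacus, to the
   vectors (x, y) in one of the six residue classes mod 3 with x^2 + xy + y^2 = 3i + 1.
   Multiplication by the units of Z[zeta_6] permutes these classes transitively, and the
   number of representations of N by this form is 6 E(N), where E(N) = sum_(d | N) chi(d) and chi
   is the character mod 3; the latter holds because both sides obey the recursion
     f(pN) = (1 + chi(p)) f(N) - chi(p) f(N/p).
   Hence A_3(n) is the convolution sum_(i + j = M) E(i) E(j), M = 3n + 2, that is, the sum of
   chi(a) chi(b) over the positive solutions of a x + b y = M; as chi(a) chi(b) =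
   [a = b mod 3] - [a = -b mod 3], Liouville's substitutions
   (a, b, x, y) -> (a - b, b, x, x + y) etc. evaluate it to sigma(M)/3. *)

(** * Divisor sums *)

Lemma uniq_perm_map (T U : eqType) (s : seq T) (t : seq U) (f : T -> U) :
  uniq s -> uniq t -> {in s &, injective f} ->
  (forall x, x \in s -> f x \in t) ->
  (forall y, y \in t -> exists2 x, x \in s & f x = y) ->
  perm_eq [seq f x | x <- s] t.
Proof.
move=> us ut injf fst tfs; apply: uniq_perm => //.
  by rewrite map_inj_in_uniq.
move=> y; apply/mapP/idP => [[x xs ->]|/tfs [x xs <-]]; first exact: fst.
by exists x.
Qed.

Lemma size_bij (T U : eqType) (s : seq T) (t : seq U) (f : T -> U) :
  uniq s -> uniq t -> {in s &, injective f} ->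
  (forall x, x \in s -> f x \in t) ->
  (forall y, y \in t -> exists2 x, x \in s & f x = y) ->
  size s = size t.
Proof.
move=> us ut injf fst tfs.
by rewrite -(perm_size (uniq_perm_map us ut injf fst tfs)) size_map.
Qed.

Lemma count_bij (T U : eqType) (s : seq T) (t : seq U) (P : pred T) (Q : pred U) (f : T -> U) (g : U -> T) :
  uniq s -> uniq t ->
  (forall x, x \in s -> P x -> [/\ f x \in t, Q (f x) & g (f x) = x]) ->
  (forall y, y \in t -> Q y -> [/\ g y \in s, P (g y) & f (g y) = y]) ->
  count P s = count Q t.
Proof.
move=> us ut hf hg; rewrite -!size_filter.
apply: (size_bij (f := f)); rewrite ?filter_uniq //.
- move=> x y; rewrite !mem_filter => /andP [Px xs] /andP [Py ys] eq_f.
  have [_ _ <-] := hf x xs Px; have [_ _ <-] := hf y ys Py.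
  by rewrite eq_f.
- move=> x; rewrite !mem_filter => /andP [Px xs].
  by have [-> ->] := hf x xs Px.
- move=> y; rewrite mem_filter => /andP [Qy yt]; have [gs Pg fg] := hg y yt Qy.
  by exists (g y) => //; rewrite mem_filter Pg.
Qed.

Local Open Scope ring_scope.

Definition divsum (g : nat -> int) (N : nat) : int := \sum_(d <- divisors N) g d.

(** A divisor of p N that does not divide N is p e with e | N and p e not dividing N. The divisors e
    left out, those with p e | N, are exactly the divisors of N / p. *)
Lemma divsum_prime (g : nat -> int) (p N : nat) :
  prime p -> (0 < N)%N -> (forall m, g (p * m)%N = g p * g m) ->
  divsum g (p * N) =
    (1 + g p) * divsum g N - g p * (if (p %| N)%N then divsum g (N %/ p) else 0).
Proof.
move=> p_pr N_gt0 gM.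
have p_gt0 := prime_gt0 p_pr.
have injp : injective (muln p) by move=> x y /eqP; rewrite eqn_pmul2l // => /eqP.
have perm1 : perm_eq (divisors (p * N))
    (divisors N ++ [seq (p * e)%N | e <- divisors N & ~~ (p * e %| N)%N]).
  apply: uniq_perm; first exact: divisors_uniq.
    rewrite cat_uniq divisors_uniq (map_inj_uniq injp) (filter_uniq _ (divisors_uniq N)) andbT /=.
    apply/hasPn => x /mapP [e]; rewrite mem_filter => /andP [pe _] ->.
    by rewrite -dvdn_divisors.
  move=> d; rewrite mem_cat -!dvdn_divisors ?muln_gt0 ?p_gt0 //.
  apply/idP/orP => [dpN|[dN|/mapP [e]]]; last first.
  - rewrite mem_filter -dvdn_divisors // => /andP [_ eN] ->.
    by rewrite dvdn_pmul2l.
  - exact: dvdn_mull.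
  case: (boolP (d %| N)%N) => dN; [by left|right].
  have /dvdnP [e de] : (p %| d)%N.
    apply: contraR dN => pd.
    by rewrite -(@Gauss_dvdr d p) // coprime_sym prime_coprime.
  apply/mapP; exists e; last by rewrite de mulnC.
  rewrite mem_filter -dvdn_divisors // mulnC -de dN /=.
  by rewrite -(dvdn_pmul2l p_gt0) mulnC -de.
rewrite {1}/divsum (perm_big _ perm1) /= big_cat /= big_map big_filter.
have -> : \sum_(e <- divisors N | ~~ (p * e %| N)%N) g (p * e)%N =
          g p * (divsum g N - \sum_(e <- divisors N | (p * e %| N)%N) g e).
  rewrite [divsum g N](bigID (fun e => (p * e %| N)%N)) /= addrAC subrr add0r mulr_sumr.
  by apply: eq_bigr => e _; rewrite gM.
suff -> : \sum_(e <- divisors N | (p * e %| N)%N) g e =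
    if (p %| N)%N then divsum g (N %/ p) else 0.
  by rewrite /divsum; ring.
case: ifP => pN; last first.
  rewrite big1 // => e peN; move: pN; rewrite (dvdn_trans _ peN) //.
  exact: dvdn_mulr.
have Np_gt0 : (0 < N %/ p)%N by rewrite divn_gt0 // dvdn_leq.
rewrite -big_filter; apply: perm_big; apply: uniq_perm.
- exact: filter_uniq (divisors_uniq N).
- exact: divisors_uniq.
move=> e; rewrite mem_filter -!dvdn_divisors // dvdn_divRL // mulnC.
apply: andb_idr => peN; apply: dvdn_trans peN.
exact: dvdn_mulr.
Qed.

(** * Liouville's identity modulo 3 *)

Definition chi (n : nat) : int :=
  if (n %% 3 == 1)%N then 1 else if (n %% 3 == 2)%N then -1 else 0.

Lemma chiM m n : chi (m * n)%N = chi m * chi n.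
Proof.
rewrite /chi -modnMm.
have := ltn_pmod m (isT : (0 < 3)%N); have := ltn_pmod n (isT : (0 < 3)%N).
by case: (m %% 3)%N => [|[|[|?]]] //; case: (n %% 3)%N => [|[|[|?]]].
Qed.

(** When 3 divides both arguments the two indicators are both 1 and cancel. *)
Lemma chi_mul_eq a b :
  chi a * chi b = (a == b %[mod 3])%N%:R - (3 %| a + b)%N%:R.
Proof.
rewrite /chi /dvdn -modnDm.
have := ltn_pmod a (isT : (0 < 3)%N); have := ltn_pmod b (isT : (0 < 3)%N).
by case: (a %% 3)%N => [|[|[|?]]] //; case: (b %% 3)%N => [|[|[|?]]].
Qed.

Definition dpairs (i : nat) : seq (nat * nat) := [seq (d, i %/ d)%N | d <- divisors i].

Lemma mem_dpairs i d e : (0 < i)%N -> ((d, e) \in dpairs i) = (d * e == i)%N.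
Proof.
move=> i_gt0; apply/mapP/eqP => [[d' dN [-> ->]]|deq].
  by rewrite mulnC divnK // dvdn_divisors.
have d_gt0 : (0 < d)%N by move: i_gt0; rewrite -deq muln_gt0 => /andP [].
exists d; first by rewrite -dvdn_divisors // -deq dvdn_mulr.
by rewrite -deq mulKn.
Qed.

Lemma dpairs_uniq i : uniq (dpairs i).
Proof. by rewrite map_inj_uniq ?divisors_uniq // => x y []. Qed.

Local Notation quad := ((nat * nat) * (nat * nat))%type.

(* A quadruple ((a, x), (b, y)) of positive integers with a x + b y = M. *)
Definition quads (M : nat) : seq quad :=
  [seq pq | i <- index_iota 1 M,
            pq <- [seq (u, v) | u <- dpairs i, v <- dpairs (M - i)]].

Lemma mem_quads M a x b y : ((a, x), (b, y)) \in quads M =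
  [&& (0 < a)%N, (0 < x)%N, (0 < b)%N, (0 < y)%N & (a * x + b * y == M)%N].
Proof.
apply/allpairsPdep/idP => [[i [pq [hi /allpairsPdep [u [v [hu hv ->]]] eq_uv]]]|].
  rewrite mem_index_iota in hi.
  move: eq_uv hu hv => [<- <-]; rewrite !mem_dpairs; try lia.
case/and5P=> a0 x0 b0 y0 /eqP eqM.
have ax : (0 < a * x)%N by rewrite muln_gt0 a0.
have yb : (0 < b * y)%N by rewrite muln_gt0 b0.
exists (a * x)%N, ((a, x), (b, y)); split => //.
  by rewrite mem_index_iota; lia.
apply/allpairsPdep; exists (a, x), (b, y); split => //.
  by rewrite mem_dpairs.
by rewrite mem_dpairs; lia.
Qed.

Lemma quads_uniq M : uniq (quads M).
Proof.
apply: allpairs_uniq_dep; first exact: iota_uniq.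
  move=> i hi; apply: allpairs_uniq; try exact: dpairs_uniq.
  by move=> [? ?] [? ?].
(* The outer index is recovered from the quadruple as a x, so the blocks for different i are
   disjoint. *)
have quadP (z : {_ : nat & quad}) :
    z \in [seq existT (fun=> ((nat * nat) * (nat * nat))%type) u v
      | u <- index_iota 1 M,
        v <- [seq (u0, v) | u0 <- dpairs u, v <- dpairs (M - u)]] ->
    projT1 z = ((projT2 z).1.1 * (projT2 z).1.2)%N.
  case/allpairsPdep=> i [pq [hi /allpairsPdep [[a x] [v [hu _ ->]]] ->]] /=.
  rewrite mem_index_iota in hi; case/andP: hi => i_gt0 _; move: hu.
  by rewrite mem_dpairs // => /eqP ->.
move=> [i u] [j v] /quadP /= hi /quadP /= hj uv.
by rewrite -uv in hj; rewrite hi hj uv.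
Qed.

Lemma sum_divsum_conv (g h : nat -> int) M :
  \sum_(1 <= i < M) divsum g i * divsum h (M - i) =
  \sum_(t <- quads M) g t.1.1 * h t.2.1.
Proof.
rewrite big_allpairs_dep; apply: eq_bigr => i _.
rewrite big_allpairs_dep big_map mulr_suml; apply: eq_bigr => a _.
by rewrite big_map mulr_sumr.
Qed.

Local Open Scope nat_scope.

Local Notation swap := (fun t : quad => (t.2, t.1)).

Lemma count_quads_swap P M : count P (quads M) = count (fun t => P (swap t)) (quads M).
Proof.
apply: (count_bij (f := swap) (g := swap)); try exact: quads_uniq.
  move=> [[a x] [b y]] h Pt; split => //=.
  by move: h; rewrite !mem_quads; lia.
move=> [[a x] [b y]] h Pt; split => //=.
by move: h; rewrite !mem_quads; lia.
Qed.

(** The substitution (a, x, b, y) -> (a - b, x, b, x + y) keeps a x + b y and turns b < a into x <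
    y. *)
Lemma count_quads_sub P M :
  count (fun t => (t.2.1 < t.1.1)%N && P (t.1.1 - t.2.1)%N) (quads M) =
  count (fun t => (t.1.2 < t.2.2)%N && P t.1.1) (quads M).
Proof.
apply: (count_bij
  (f := fun t => ((t.1.1 - t.2.1, t.1.2), (t.2.1, t.1.2 + t.2.2))%N)
  (g := fun t => ((t.1.1 + t.2.1, t.1.2), (t.2.1, t.2.2 - t.1.2))%N));
  try exact: quads_uniq.
all: move=> [[a x] [b y]]; rewrite mem_quads /= => h /andP [lt Pt]; split.
- by rewrite mem_quads; move: h => /and5P [? ? ? ? /eqP ?]; apply/and5P; split; nia.
- by rewrite Pt andbT; lia.
- by congr (_, _); congr (_, _); lia.
- by rewrite mem_quads; move: h => /and5P [? ? ? ? /eqP ?]; apply/and5P; split; nia.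
- by rewrite addnK Pt andbT; lia.
- by congr (_, _); congr (_, _); lia.
Qed.

(** Here (a, x, b, y) -> (a, x - y, a + b, y) turns y < x into a < b, and the old a + b becomes the
    new b. *)
Lemma count_quads_add P M :
  count (fun t => (t.2.2 < t.1.2)%N && P (t.1.1 + t.2.1)%N) (quads M) =
  count (fun t => (t.1.1 < t.2.1)%N && P t.2.1) (quads M).
Proof.
apply: (count_bij
  (f := fun t => ((t.1.1, t.1.2 - t.2.2), (t.1.1 + t.2.1, t.2.2))%N)
  (g := fun t => ((t.1.1, t.1.2 + t.2.2), (t.2.1 - t.1.1, t.2.2))%N));
  try exact: quads_uniq.
all: move=> [[a x] [b y]]; rewrite mem_quads /= => h /andP [lt Pt]; split.
- by rewrite mem_quads; move: h => /and5P [? ? ? ? /eqP ?]; apply/and5P; split; nia.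
- by rewrite Pt andbT; move: h => /and5P [? ? ? ? /eqP ?]; lia.
- by congr (_, _); congr (_, _); lia.
- by rewrite mem_quads; move: h => /and5P [? ? ? ? /eqP ?]; apply/and5P; split; nia.
- by rewrite subnKC ?(ltnW lt) // Pt andbT; move: h => /and5P [? ? ? ? /eqP ?]; lia.
- by congr (_, _); congr (_, _); lia.
Qed.

(** The inverse of the substitution in [count_quads_add], now used with a predicate on a, which it
    fixes. *)
Lemma count_quads_lt P M :
  count (fun t => (t.1.1 < t.2.1)%N && P t.1.1) (quads M) =
  count (fun t => (t.2.2 < t.1.2)%N && P t.1.1) (quads M).
Proof.
apply: (count_bij
  (f := fun t => ((t.1.1, t.1.2 + t.2.2), (t.2.1 - t.1.1, t.2.2))%N)
  (g := fun t => ((t.1.1, t.1.2 - t.2.2), (t.1.1 + t.2.1, t.2.2))%N));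
  try exact: quads_uniq.
all: move=> [[a x] [b y]]; rewrite mem_quads /= => h /andP [lt Pt]; split.
- by rewrite mem_quads; move: h => /and5P [? ? ? ? /eqP ?]; apply/and5P; split; nia.
- by rewrite Pt andbT; move: h => /and5P [? ? ? ? /eqP ?]; lia.
- by congr (_, _); congr (_, _); lia.
- by rewrite mem_quads; move: h => /and5P [? ? ? ? /eqP ?]; apply/and5P; split; nia.
- by rewrite Pt andbT; move: h => /and5P [? ? ? ? /eqP ?]; lia.
- by congr (_, _); congr (_, _); lia.
Qed.

Lemma count_tri (T : eqType) (s : seq T) (P : pred T) (u v : T -> nat) :
  count P s = (count (fun t => (u t < v t)%N && P t) s +
               count (fun t => (v t < u t)%N && P t) s +
               count (fun t => (u t == v t)%N && P t) s)%N.
Proof. elim: s => //= t s ->; case: (P t); case: ltngtP => /= _; rewrite ?andbF ?andbT /=; lia. Qed.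

(* Liouville's identity for the even function k |-> [3 %| k]; the diagonal terms
   where 3 divides a divisor of M vanish. *)
Lemma count_quads_mod3 M : ~~ (3 %| M)%N ->
  (count (fun t : quad => t.1.1 == t.2.1 %[mod 3]) (quads M) +
   2 * count (fun t : quad => (t.1.2 == t.2.2) && (3 %| t.1.1)) (quads M) =
   count (fun t : quad => 3 %| t.1.1 + t.2.1) (quads M) +
   count (fun t : quad => t.1.1 == t.2.1) (quads M))%N.
Proof.
move=> M3; set c := fun P => count P (quads M); rewrite -!/(c _).
have eqc P Q : P =1 Q -> c P = c Q by move=> h; apply: eq_count.
have c0 (P : pred _) : (forall a x b y, (a * x + b * y = M)%N -> ~~ P ((a, x), (b, y))) -> c P = 0%N.
  move=> h; apply/eqP; rewrite eqn0Ngt -has_count; apply/hasPn => -[[a x] [b y]].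
  by rewrite mem_quads => /and5P [_ _ _ _ /eqP /h].
(* Write # for counts. By symmetry and the substitutions, #(a = b mod 3) = 2 #(x < y, 3 | a) + #(a =
   b) and #(3 | a + b) = 2 #(b < a, 3 | a). Splitting #(3 | a) once by a, b and once by x, y, and
   cancelling #(a < b, 3 | a) = #(y < x, 3 | a), gives #(b < a, 3 | a) = #(x < y, 3 | a) + #(x = y,
   3 | a). *)
have e1 := count_tri (quads M) (fun t => t.1.1 == t.2.1 %[mod 3]) (fun t => t.1.1) (fun t => t.2.1).
have e2 := count_tri (quads M) (fun t => 3 %| t.1.1 + t.2.1)%N (fun t => t.1.2) (fun t => t.2.2).
have e3 := count_tri (quads M) (fun t => 3 %| t.1.1)%N (fun t => t.1.1) (fun t => t.2.1).
have e4 := count_tri (quads M) (fun t => 3 %| t.1.1)%N (fun t => t.1.2) (fun t => t.2.2).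
have s1 := count_quads_swap (fun t => (t.1.1 < t.2.1)%N && (t.1.1 == t.2.1 %[mod 3])) M.
have s2 := count_quads_swap (fun t => (t.1.2 < t.2.2)%N && (3 %| t.1.1 + t.2.1)%N) M.
have s3 := count_quads_swap (fun t => (t.1.1 < t.2.1)%N && (3 %| t.2.1)%N) M.
have b1 := count_quads_sub (fun k => 3 %| k)%N M.
have b2 := count_quads_add (fun k => 3 %| k)%N M.
have b3 := count_quads_lt (fun k => 3 %| k)%N M.
rewrite /= -!/(c _) in e1 e2 e3 e4 s1 s2 s3 b1 b2 b3.
have d1 : c (fun t => (t.1.1 == t.2.1) && (t.1.1 == t.2.1 %[mod 3])) =
          c (fun t => t.1.1 == t.2.1).
  by apply: eqc => t; case: eqP => //= ->; rewrite eqxx.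
have d2 : c (fun t => (t.1.2 == t.2.2) && (3 %| t.1.1 + t.2.1)%N) = 0%N.
  apply: c0 => a x b y /= eqM; apply/negP => /andP [/eqP exy h3].
  by move: M3; rewrite -eqM exy -mulnDl dvdn_mulr.
have d3 : c (fun t => (t.1.1 == t.2.1) && (3 %| t.1.1)%N) = 0%N.
  apply: c0 => a x b y /= eqM; apply/negP => /andP [/eqP exy h3].
  by move: M3; rewrite -eqM -exy -mulnDr dvdn_mulr.
have d4 : c (fun t => (t.2.1 < t.1.1)%N && (t.2.1 == t.1.1 %[mod 3])) =
          c (fun t => (t.2.1 < t.1.1)%N && (3 %| t.1.1 - t.2.1)%N).
  by apply: eqc => t; case: ltnP => //= h; rewrite eq_sym eqn_mod_dvd // ltnW.
have d5 : c (fun t => (t.2.1 < t.1.1)%N && (t.1.1 == t.2.1 %[mod 3])) =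
          c (fun t => (t.2.1 < t.1.1)%N && (3 %| t.1.1 - t.2.1)%N).
  by apply: eqc => t; case: ltnP => //= h; rewrite eqn_mod_dvd // ltnW.
have d6 : c (fun t => (t.2.2 < t.1.2)%N && (3 %| t.2.1 + t.1.1)%N) =
          c (fun t => (t.2.2 < t.1.2)%N && (3 %| t.1.1 + t.2.1)%N).
  by apply: eqc => t; rewrite addnC.
lia.
Qed.

(** These pairs serve as a set of size sum F(d), to be matched bijectively with the two diagonal
    families of quadruples. *)
Lemma size_dep_pairs (F : nat -> nat) s :
  size [seq (d, k) | d <- s, k <- iota 1 (F d)] = \sum_(d <- s) F d.
Proof.
rewrite size_allpairs_dep sumnE big_map; apply: eq_bigr => d _.
by rewrite size_iota.
Qed.

Lemma mem_dep_pairs (F : nat -> nat) s d k :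
  ((d, k) \in [seq (d, k) | d <- s, k <- iota 1 (F d)]) = (d \in s) && (0 < k <= F d).
Proof.
apply/allpairsPdep/andP => [[d' [k' [ds hk [-> ->]]]]|[ds hk]].
  by split=> //; rewrite mem_iota in hk; lia.
by exists d, k; split=> //; rewrite mem_iota; lia.
Qed.

Lemma dep_pairs_uniq (F : nat -> nat) s :
  uniq s -> uniq [seq (d, k) | d <- s, k <- iota 1 (F d)].
Proof.
move=> us; apply: allpairs_uniq_dep => // [d _|]; first exact: iota_uniq.
by move=> [d k] [d' k'] _ _ /= [-> ->].
Qed.

(** With a = b the equation is a (x + y) = M: the divisor is d = x + y, and x runs over 1, ..., d -
    1. *)
Lemma count_quads_diag M : 0 < M ->
  count (fun t : quad => t.1.1 == t.2.1) (quads M) = \sum_(d <- divisors M) d.-1.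
Proof.
move=> M0; rewrite -size_dep_pairs -count_predT.
apply: (count_bij (f := fun t : quad => (t.1.2 + t.2.2, t.1.2))
  (g := fun dk : nat * nat => ((M %/ dk.1, dk.2), (M %/ dk.1, dk.1 - dk.2)))).
- exact: quads_uniq.
- exact: dep_pairs_uniq (divisors_uniq M).
- move=> [[a x] [b y]]; rewrite mem_quads /= => /and5P [a0 x0 b0 y0 /eqP eqM] /eqP eab.
  subst b; rewrite -mulnDr in eqM; split=> //.
    rewrite mem_dep_pairs -dvdn_divisors // -eqM dvdn_mull //=.
    by lia.
  have -> : M %/ (x + y) = a by rewrite -eqM mulnK //; lia.
  by rewrite addKn.
- move=> [d k]; rewrite mem_dep_pairs -dvdn_divisors // => /andP [dM hk] _.
  have d0 := dvdn_gt0 M0 dM.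
  split=> //=; last by congr (_, _); lia.
  rewrite mem_quads -mulnDr subnKC; last by lia.
  rewrite divnK // eqxx !divn_gt0 //; have := dvdn_leq M0 dM.
  by lia.
Qed.

(** With x = y the equation is (a + b) x = M: the divisor is d = a + b, and a = 3 k with 0 < 3 k <
    d. As 3 does not divide d, there are floor(d / 3) such k. *)
Lemma count_quads_codiag M : ~~ (3 %| M) ->
  count (fun t : quad => (t.1.2 == t.2.2) && (3 %| t.1.1)) (quads M) =
  \sum_(d <- divisors M) d %/ 3.
Proof.
move=> M3; have M0 : 0 < M by case: M M3.
rewrite -size_dep_pairs -count_predT.
apply: (count_bij (f := fun t : quad => (t.1.1 + t.2.1, t.1.1 %/ 3))
  (g := fun dk : nat * nat =>
    ((3 * dk.2, M %/ dk.1), (dk.1 - 3 * dk.2, M %/ dk.1)))).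
- exact: quads_uniq.
- exact: dep_pairs_uniq (divisors_uniq M).
- move=> [[a x] [b y]]; rewrite mem_quads /= => /and5P [a0 x0 b0 y0 /eqP eqM].
  case/andP=> /eqP exy a3; subst y; rewrite -mulnDl in eqM.
  case/dvdnP: a3 => k ak; subst a; rewrite mulnK //; split=> //.
    rewrite mem_dep_pairs -dvdn_divisors // -eqM dvdn_mulr //=.
    by lia.
  have -> : M %/ (k * 3 + b) = x by rewrite -eqM mulKn //; lia.
  by rewrite [3 * k]mulnC addKn.
- move=> [d k]; rewrite mem_dep_pairs -dvdn_divisors // => /andP [dM hk] _.
  have d0 := dvdn_gt0 M0 dM.
  have d3 : ~~ (3 %| d) by apply: contra M3 => /dvdn_trans; apply.
  have kd : 3 * k < d by lia.
  split=> //=; last by congr (_, _); lia.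
  - rewrite mem_quads -mulnDl subnKC ?(ltnW kd) //.
    rewrite [d * _]mulnC divnK // eqxx !divn_gt0 //; have := dvdn_leq M0 dM.
    by lia.
  - by rewrite eqxx dvdn_mulr.
Qed.

Local Open Scope ring_scope.

(** By the identity above the convolution is the sum over d | M of (d - 1) - 2 floor(d / 3). For d
    prime to 3, three times this term is d - chi(d), and the chi(d) add up to 0. *)
Lemma divsum_chi_conv (M : nat) : (M %% 3 = 2)%N -> divsum chi M = 0 ->
  3 * (\sum_(1 <= i < M) divsum chi i * divsum chi (M - i)) =
  divsum (fun d => d%:R) M.
Proof.
move=> M2 E0; have M3 : ~~ (3 %| M)%N by rewrite /dvdn M2.
have M0 : (0 < M)%N by case: (M) M3.
have countE (P : pred quad) : \sum_(t <- quads M) (P t)%:R = (count P (quads M))%:R :> int.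
  by elim: (quads M) => [|t s IHs]; rewrite ?big_nil // big_cons IHs /= natrD.
rewrite sum_divsum_conv; under eq_bigr do rewrite chi_mul_eq.
rewrite sumrB !countE.
have := count_quads_mod3 M3; rewrite count_quads_diag // count_quads_codiag // => h.
suff h3 : (3 * (\sum_(d <- divisors M) d.-1) =
      (\sum_(d <- divisors M) d) + 6 * (\sum_(d <- divisors M) d %/ 3))%N.
  rewrite /divsum -natr_sum; lia.
apply/eqP; rewrite -(eqr_nat int) -subr_eq0; apply/eqP.
transitivity (- divsum chi M); last by rewrite E0 oppr0.
rewrite natrD !natrM !natr_sum !mulr_sumr -big_split /= -sumrB /divsum -sumrN.
apply: eq_big_seq => d; rewrite -dvdn_divisors // => dM.
have d0 := dvdn_gt0 M0 dM.
have d3 : ~~ (3 %| d)%N by apply: contra M3 => /dvdn_trans; apply.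
by rewrite /chi; case: ifP => h1; [|case: ifP => h2]; lia.
Qed.

(** * Representations by x^2 + xy + y^2 *)

(* The norm of x + y zeta in Z[zeta], zeta = exp(i pi / 3). *)
Definition eis (t : int * int) : int := t.1 ^+ 2 + t.1 * t.2 + t.2 ^+ 2.

(** Four times the form is (2 u + v)^2 + 3 v^2, so 3 v^2 <= 4 B. This makes the search box in [reps]
    exhaustive. *)
Lemma eis_bound x y (B : nat) : eis (x, y) <= B%:Z -> (`|x| <= B)%N /\ (`|y| <= B)%N.
Proof.
have aux (u v : int) : u ^+ 2 + u * v + v ^+ 2 <= B%:Z -> (`|v| <= B)%N.
  move=> h; have h1 := sqr_ge0 (2 * u + v).
  have h2 : 3 * v ^+ 2 <= 4 * B%:Z by lia.
  suff : v ^+ 2 < (B%:Z + 1) ^+ 2 by nia.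
  by nia.
move=> h; split; last exact: aux h.
by apply: (aux y); move: h; rewrite /eis /=; lia.
Qed.

Definition zrange (B : nat) : seq int := [seq k%:Z - B%:Z | k <- iota 0 (2 * B).+1].

Lemma mem_zrange B x : (x \in zrange B) = (`|x| <= B)%N.
Proof.
apply/mapP/idP => [[k]|h]; first by rewrite mem_iota => h ->; lia.
exists (absz (x + B%:Z)); last by lia.
by rewrite mem_iota; lia.
Qed.

Lemma zrange_uniq B : uniq (zrange B).
Proof. by rewrite map_inj_uniq ?iota_uniq // => i j; lia. Qed.

Definition reps (N : nat) : seq (int * int) :=
  [seq t <- [seq (x, y) | x <- zrange N, y <- zrange N] | eis t == N%:Z].

Lemma mem_reps N t : (t \in reps N) = (eis t == N%:Z).
Proof.
case: t => x y; rewrite mem_filter; apply: andb_idr => /eqP h.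
have [hx hy] : (`|x| <= N)%N /\ (`|y| <= N)%N by apply: eis_bound; rewrite h.
by apply: allpairs_f; rewrite mem_zrange.
Qed.

Lemma reps_uniq N : uniq (reps N).
Proof.
apply: filter_uniq; apply: allpairs_uniq; try exact: zrange_uniq.
by move=> [? ?] [? ?].
Qed.

Lemma eis_scale (c : int) x y : eis (c * x, c * y) = c ^+ 2 * eis (x, y).
Proof. by rewrite /eis /=; ring. Qed.

(** * Inert and split primes *)

Lemma eis_dvdF (p : nat) x y : prime p ->
  (p %| eis (x, y))%Z = (x%:~R ^+ 2 + x%:~R * y%:~R + y%:~R ^+ 2 == 0 :> 'F_p).
Proof.
by move=> p_pr; rewrite (dvdz_pcharf (pchar_Fp p_pr)) /eis !rmorphD /= !rmorphM.
Qed.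

Lemma Fp_exp (p : nat) (z : 'F_p) : prime p -> z ^+ p = z.
Proof.
by move=> p_pr; rewrite -[z]natr_Zp -natrX -(Fp_nat_mod p_pr) fermat_little ?Fp_nat_mod.
Qed.

(** Modulo p a zero of the form has x^3 = y^3. For p = 3 q + 2 Fermat gives (z^3)^q z = 1 for z
    nonzero, so a nonzero element is determined by its cube; hence x = y and 3 x^2 = 0. *)
Lemma eis_inert (p : nat) x y : prime p -> (p %% 3 = 2)%N ->
  (p %| eis (x, y))%Z -> (p %| x)%Z /\ (p %| y)%Z.
Proof.
move=> p_pr p2; rewrite eis_dvdF // !(dvdz_pcharf (pchar_Fp p_pr)).
move: (x%:~R) (y%:~R) => {}x {}y /eqP xy0.
have x3 : x ^+ 3 = y ^+ 3.
  apply/eqP; rewrite -subr_eq0; apply/eqP.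
  by transitivity ((x - y) * (x ^+ 2 + x * y + y ^+ 2)); [ring|rewrite xy0 mulr0].
have pE : p = (3 * (p %/ 3) + 2)%N by rewrite {1}(divn_eq p 3) p2 mulnC.
have fermat (z : 'F_p) : (z ^+ 3) ^+ (p %/ 3) * z ^+ 2 = z.
  by rewrite -exprM -exprD -pE Fp_exp.
have [y0|ny0] := eqVneq y 0.
  by move: xy0; rewrite y0 mulr0 expr0n /= !addr0 => /eqP; rewrite expf_eq0.
have nx0 : x != 0.
  apply: contraNneq ny0 => x0; move: x3; rewrite x0 expr0n /= => /esym/eqP.
  by rewrite expf_eq0.
have h (z : 'F_p) : z != 0 -> (z ^+ 3) ^+ (p %/ 3) * z = 1.
  by move=> nz; apply: (mulIf nz); rewrite mul1r -mulrA -expr2 fermat.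
have exy : x = y by rewrite -[LHS]mulr1 -(h y ny0) -x3 mulrCA mulrA h // mul1r.
have : (3 : 'F_p) * x ^+ 2 = 0 by rewrite -xy0 -exy; ring.
move/eqP; rewrite mulf_eq0 expf_eq0 /= (negPf nx0) orbF -(dvdn_pcharf (pchar_Fp p_pr)).
by rewrite dvdn_prime2 // => /eqP p3; rewrite p3 in p2.
Qed.

(** By [eis_inert] each representation of p N is p s with p eis(s) = N, so dividing by p leads to
    the representations of N / p, and there are none unless p divides N. *)
Lemma size_reps_inert (p N : nat) : prime p -> (p %% 3 = 2)%N -> (0 < N)%N ->
  size (reps (p * N)) = if (p %| N)%N then size (reps (N %/ p)) else 0%N.
Proof.
move=> p_pr p2 N0; have p0 := prime_gt0 p_pr.
have pn0 : p%:Z != 0 by lia.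
have key t : t \in reps (p * N) -> exists2 s, t = (p%:Z * s.1, p%:Z * s.2) & p%:Z * eis s = N%:Z.
  case: t => x y; rewrite mem_reps => /eqP e.
  have [|/dvdzP [x' ex] /dvdzP [y' ey]] := @eis_inert p x y p_pr p2.
    by rewrite e PoszM dvdz_mulr.
  exists (x', y'); rewrite /= ?ex ?ey ?[_ * p%:Z]mulrC //.
  by move: e; rewrite ex ey ![_ * p%:Z]mulrC eis_scale => e; apply: (mulfI pn0);
    rewrite mulrA -expr2 e PoszM.
case: ifP => pN.
  symmetry; apply: (size_bij (f := fun s : int * int => (p%:Z * s.1, p%:Z * s.2))); try exact: reps_uniq.
  - by move=> [x y] [x' y'] _ _ /= [/(mulfI pn0) -> /(mulfI pn0) ->].
  - move=> [x y]; rewrite !mem_reps => /eqP e; rewrite eis_scale e.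
    by case/dvdnP: pN => M ->; rewrite mulnK //; apply/eqP; rewrite !PoszM; ring.
  - move=> t /key [s -> e]; exists s => //; rewrite mem_reps.
    by case/dvdnP: pN e => M ->; rewrite mulnK // PoszM [_ * p%:Z]mulrC => /(mulfI pn0) ->.
apply/eqP; rewrite size_eq0; apply/eqP; case Er: (reps _) => [|t r] //.
have /key [s _ e] : t \in reps (p * N) by rewrite Er mem_head.
by move: pN; rewrite -[(p %| N)%N]/(p%:Z %| N%:Z)%Z -e dvdz_mulr.
Qed.

(** The p - 1 nonzero residues are (p - 1)-th roots of unity, so one of them, z, is primitive; z^((p
    - 1) / 3) is then a cube root of 1 other than 1. *)
Lemma cube_root_unity (p : nat) : prime p -> (p %% 3 = 1)%N ->
  exists w : 'F_p, w ^+ 2 + w + 1 = 0.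
Proof.
move=> p_pr p1; have p_gt1 := prime_gt1 p_pr.
have p1_gt0 : (0 < p.-1)%N by lia.
pose rs := [seq z : 'F_p <- enum 'F_p | z != 0].
have urs : uniq rs by rewrite filter_uniq // enum_uniq.
have srs : size rs = p.-1.
  transitivity #|'F_p|.-1; last by rewrite card_Fp.
  by rewrite -(cardC1 (0 : 'F_p)) cardE /rs enumT; congr size; apply: eq_filter.
have ars : all (p.-1).-unity_root rs.
  apply/allP => z; rewrite mem_filter => /andP [nz _]; apply/unity_rootP.
  apply: (mulIf nz); rewrite mul1r -exprSr prednK ?(ltnW p_gt1) //.
  exact: Fp_exp.
have /hasP [z _ zp] := has_prim_root p1_gt0 ars urs (eq_leq (esym srs)).
have d3 : (p.-1 = p.-1 %/ 3 * 3)%N by lia.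
exists (z ^+ (p.-1 %/ 3)); set w := z ^+ _.
have w3 : w ^+ 3 = 1 by rewrite -exprM -d3; apply: prim_expr_order.
have w1 : w - 1 != 0.
  rewrite subr_eq0 -(prim_order_dvd zp); apply/negP => /dvdn_leq; lia.
apply: (mulfI w1); rewrite mulr0; transitivity (w ^+ 3 - 1); first by ring.
by rewrite w3 subrr.
Qed.

Lemma eis_split (p : nat) : prime p -> (p %% 3 = 1)%N -> exists t, eis t = p%:Z.
Proof.
move=> p_pr p1; have p_gt1 := prime_gt1 p_pr.
have [w w0] := cube_root_unity p_pr p1.
(* The integer square root of p; the bound m^2 < p is strict because a prime is not a square. *)
have [m mp pm] : exists2 m, (m * m < p)%N & (p < m.+1 * m.+1)%N.
  have [m h1 h2] : exists2 m, (m * m <= p)%N & (p < m.+1 * m.+1)%N.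
    elim: (p) => [|q [m h1 h2]]; first by exists 0%N.
    case: (ltnP q.+1 (m.+1 * m.+1)%N) => h; first by exists m; lia.
    by exists m.+1; nia.
  exists m => //; rewrite ltn_neqAle h1 andbT; apply/eqP => e.
  have /primeP [_ hp] := p_pr.
  by have := hp m; rewrite -e dvdn_mulr // => /(_ isT); nia.
(* Thue: by pigeonhole some nonzero u, v with |u|, |v| <= m satisfy u = w v mod p. *)
pose f (ij : 'I_m.+1 * 'I_m.+1) : 'F_p := ij.1%:R - w * ij.2%:R.
have : ~~ injectiveb f.
  apply/negP => /injectiveP /leq_card; rewrite card_Fp // card_prod !card_ord; lia.
case/injectivePn => -[i j] [[i' j']] /negP neq; rewrite /f /= => eqf.
pose u := i%:Z - i'%:Z; pose v := j%:Z - j'%:Z.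
have hi := ltn_ord i; have hj := ltn_ord j; have hi' := ltn_ord i'; have hj' := ltn_ord j'.
have uv0 : ~ (u = 0 /\ v = 0).
  move=> [u0 v0]; apply: neq; apply/eqP; congr (_, _); apply/val_inj => /=; lia.
have : (p %| eis (u, v))%Z.
  rewrite eis_dvdF // !rmorphB /= -!pmulrn.
  have -> : i%:R - i'%:R = w * (j%:R - j'%:R) :> 'F_p.
    apply/eqP; rewrite mulrBr -subr_eq0; apply/eqP.
    by transitivity ((i%:R - w * j%:R) - (i'%:R - w * j'%:R)); [ring|rewrite eqf subrr].
  set d := _ - _ : 'F_p; apply/eqP.
  by transitivity ((w ^+ 2 + w + 1) * d ^+ 2); [ring|rewrite w0 mul0r].
case/dvdzP => q eq_q.
(* The vector is nonzero with |u|, |v| <= m, so 0 < eis(u, v) <= 3 m^2 < 3 p. *)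
have q12 : q = 1 \/ q = 2.
  suff : 0 < q < 3 by lia.
  move: eq_q uv0; rewrite /eis /= => eq_q uv0.
  have : 0 < u ^+ 2 + u * v + v ^+ 2 by nia.
  have hu : (u ^+ 2 <= m%:Z * m%:Z) by nia.
  have hv : (v ^+ 2 <= m%:Z * m%:Z) by nia.
  have huv : (u * v <= m%:Z * m%:Z) by nia.
  nia.
case: q12 => e; first by exists (u, v); rewrite eq_q e mul1r.
(* Excludes q = 2: the prime 2 is inert, so u and v would be even, 4 would divide 2 p, and p would
   be 2. *)
case: (@eis_inert 2 u v) => // [|/dvdzP [u' eu] /dvdzP [v' ev]].
  by rewrite eq_q e dvdz_mulr.
move: eq_q; rewrite eu ev e /eis /= => h.
have : (2 %| p)%N by lia.
by rewrite dvdn_prime2 // => /eqP p2; rewrite -p2 in p1.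
Qed.

Lemma Euclid_dvdzM (p : nat) (a b : int) : prime p ->
  (p %| a * b)%Z = (p %| a)%Z || (p %| b)%Z.
Proof. by move=> p_pr; rewrite !dvdzE abszM Euclid_dvdM. Qed.

Lemma dvdzD (d m n : int) : (d %| m)%Z -> (d %| n)%Z -> (d %| m + n)%Z.
Proof. exact: rpredD. Qed.

Lemma dvdzB (d m n : int) : (d %| m)%Z -> (d %| n)%Z -> (d %| m - n)%Z.
Proof. exact: rpredB. Qed.

(** Inclusion-exclusion over the two conjugate primes above p = pi pi': each representation of p N
    is divisible by one of them. Multiplication by pi identifies those divisible by pi with the
    representations of N, conjugation exchanges the two kinds, and those divisible by both are p
    times a representation of N / p. *)
Lemma size_reps_split (p N : nat) : prime p -> (p %% 3 = 1)%N -> (0 < N)%N ->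
  (size (reps (p * N)) + (if (p %| N)%N then size (reps (N %/ p)) else 0) =
   2 * size (reps N))%N.
Proof.
move=> p_pr p1 N0; have p0 := prime_gt0 p_pr.
have pn0 : p%:Z != 0 by lia.
have [[u v] Epi] := eis_split p_pr p1.
have pE : u ^+ 2 + u * v + v ^+ 2 = p%:Z by [].
(* [P1 t] and [P2 t] say that pi = u + v zeta, resp. its conjugate, divides t. *)
pose P1 (t : int * int) := (p %| t.1 * v - t.2 * u)%Z.
pose P2 (t : int * int) := (p %| t.1 * v + t.2 * u + t.2 * v)%Z.
(* Conjugation sends zeta to 1 - zeta. *)
pose conj (t : int * int) := (t.1 + t.2, - t.2).
have conjK : involutive conj by move=> [x y]; rewrite /conj /=; congr (_, _); ring.
have eis_conj t : eis (conj t) = eis t by case: t => x y; rewrite /eis /=; ring.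
(* Otherwise p divides u as well, and p^2 divides the norm p of pi. *)
have pv : ~~ (p %| v)%Z.
  apply/negP => hv; have hu : (p %| u)%Z.
    have : (p %| u * u)%Z.
      have -> : u * u = p%:Z - (u + v) * v by rewrite -pE; ring.
      by apply: dvdzB; [exact: dvdzz | exact: dvdz_mull].
    by rewrite Euclid_dvdzM // orbb.
  case/dvdzP: hv => v' ev; case/dvdzP: hu => u' eu.
  have : p%:Z * (p%:Z * eis (u', v')) = p%:Z * 1.
    by rewrite mulr1 -{3}pE ev eu /eis /=; ring.
  move/(mulfI pn0) => h; have : (p%:Z %| 1%R)%Z by rewrite -h dvdz_mulr.
  by rewrite dvdzE /= dvdn1 => /eqP e; rewrite e in p_pr.
have P12 : count (predU P1 P2) (reps (p * N)) = size (reps (p * N)).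
  apply/eqP; rewrite -all_count; apply/allP => -[x y]; rewrite mem_reps => /eqP e.
  rewrite /= -Euclid_dvdzM //.
  have -> : (x * v - y * u) * (x * v + y * u + y * v) = v ^+ 2 * eis (x, y) - y ^+ 2 * p%:Z.
    by rewrite -pE /eis /=; ring.
  by rewrite e PoszM; apply: dvdzB; apply: dvdz_mull; rewrite ?dvdzz ?dvdz_mulr.
have cP2 : count P2 (reps (p * N)) = count P1 (reps (p * N)).
  apply: (count_bij (f := conj) (g := conj)); try exact: reps_uniq.
  - move=> [x y]; rewrite !mem_reps eis_conj /P1 /P2 /= => -> h; split=> //.
    by apply: etrans h; congr (_ %| _)%Z; ring.
  - move=> [x y]; rewrite !mem_reps eis_conj /P1 /P2 /= => -> h; split=> //.
    by apply: etrans h; congr (_ %| _)%Z; ring.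
have cP1 : size (reps N) = count P1 (reps (p * N)).
  rewrite -size_filter.
  (* Multiplication by pi, with zeta^2 = zeta - 1. *)
  apply: (size_bij (f := fun t : int * int => (u * t.1 - v * t.2, u * t.2 + v * t.1 + v * t.2)));
    [exact: reps_uniq | exact: filter_uniq (reps_uniq _) | | |].
  - move=> [x y] [x' y'] _ _ /= [e1 e2].
    have ex : p%:Z * x = p%:Z * x'.
      transitivity ((u + v) * (u * x - v * y) + v * (u * y + v * x + v * y)).
        by rewrite -pE; ring.
      by rewrite e1 e2 -pE; ring.
    have ey : p%:Z * y = p%:Z * y'.
      transitivity (u * (u * y + v * x + v * y) - v * (u * x - v * y)).
        by rewrite -pE; ring.
      by rewrite e1 e2 -pE; ring.
    by rewrite (mulfI pn0 ex) (mulfI pn0 ey).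
  - move=> [x y]; rewrite mem_reps => /eqP e; rewrite mem_filter mem_reps; apply/andP; split.
      rewrite /P1 /=.
      have -> : (u * x - v * y) * v - (u * y + v * x + v * y) * u = - y * p%:Z by rewrite -pE; ring.
      exact: dvdz_mull.
    by rewrite PoszM -e -pE /eis /=; apply/eqP; ring.
  - move=> [x y]; rewrite mem_filter mem_reps => /andP [h /eqP e].
    (* The product of t with the conjugate of pi has coordinates x (u + v) + v y and -(x v - y u),
       and its norm is p eis(t). Since p divides the second coordinate it divides the first;
       dividing both by p gives the preimage of t. *)
    have hA : (p %| x * (u + v) + v * y)%Z.
      suff : (p %| (x * (u + v) + v * y) * (x * (u + v) + v * y))%Z by rewrite Euclid_dvdzM // orbb.
      have -> : (x * (u + v) + v * y) * (x * (u + v) + v * y) =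
          p%:Z * eis (x, y) + (x * v - y * u) * ((x * (u + v) + v * y) - (x * v - y * u)).
        by rewrite -pE /eis /=; ring.
      by apply: dvdzD; apply: dvdz_mulr.
    case/dvdzP: hA => x' ex; case/dvdzP: (h : (p %| x * v - y * u)%Z) => y' ey.
    have e1 : u * x' - v * (- y') = x.
      apply: (mulfI pn0); transitivity (u * (x' * p%:Z) + v * (y' * p%:Z)); first by ring.
      by rewrite -ex -ey -pE; ring.
    have e2 : u * (- y') + v * x' + v * (- y') = y.
      apply: (mulfI pn0); transitivity (v * (x' * p%:Z) - (u + v) * (y' * p%:Z)); first by ring.
      by rewrite -ex -ey -pE; ring.
    exists (x', - y'); last by rewrite /= e1 e2.
    rewrite mem_reps; apply/eqP/(mulfI pn0).
    by rewrite -PoszM -e -e1 -e2 -pE /eis /=; ring.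
have p3 : ~~ (p %| 3)%N.
  by rewrite dvdn_prime2 //; apply/eqP => e; rewrite e in p1.
have cP3 : count (predI P1 P2) (reps (p * N)) =
    if (p %| N)%N then size (reps (N %/ p)) else 0%N.
  (* The two conditions differ by y (2 u + v), and p does not divide 2 u + v because (2 u + v)^2 = 4
     p - 3 v^2. *)
  have key x y : (p %| x * v - y * u)%Z -> (p %| x * v + y * u + y * v)%Z ->
      (p %| x)%Z /\ (p %| y)%Z.
    move=> h1 h2; have hy : (p %| y)%Z.
      have : (p %| y * (2 * u + v))%Z.
        have -> : y * (2 * u + v) = (x * v + y * u + y * v) - (x * v - y * u) by ring.
        exact: dvdzB.
      rewrite Euclid_dvdzM // => /orP [//|h].
      have : (p %| 3%:Z * (v * v))%Z.
        have -> : 3%:Z * (v * v) = 4 * p%:Z - (2 * u + v) * (2 * u + v) by rewrite -pE; ring.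
        by apply: dvdzB; apply: dvdz_mull.
      by rewrite !Euclid_dvdzM // (negPf pv) !orbF dvdzE /= (negPf p3).
    split=> //; have : (p %| x * v)%Z.
      have -> : x * v = (x * v - y * u) + y * u by ring.
      by apply: dvdzD => //; apply: dvdz_mulr.
    by rewrite Euclid_dvdzM // (negPf pv) orbF.
  rewrite -size_filter; case: ifP => pN.
    symmetry; apply: (size_bij (f := fun s : int * int => (p%:Z * s.1, p%:Z * s.2)));
      [exact: reps_uniq | exact: filter_uniq (reps_uniq _) | | |].
    + by move=> [x y] [x' y'] _ _ /= [/(mulfI pn0) -> /(mulfI pn0) ->].
    + move=> [x y]; rewrite mem_reps => /eqP e; rewrite mem_filter mem_reps eis_scale; apply/andP; split.
        rewrite /P1 /P2 /=; apply/andP; split.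
          by rewrite -!mulrA -mulrBr dvdz_mulr.
        by rewrite -!mulrA -!mulrDr dvdz_mulr.
      by rewrite e; case/dvdnP: pN => M ->; rewrite mulnK //; apply/eqP; rewrite !PoszM; ring.
    + move=> [x y]; rewrite mem_filter mem_reps /P1 /P2 /= => /andP [/andP [h1 h2] /eqP e].
      have [/dvdzP [x' ex] /dvdzP [y' ey]] := key x y h1 h2.
      exists (x', y'); last by rewrite ex ey /= ![_ * p%:Z]mulrC.
      move: e; rewrite ex ey ![_ * p%:Z]mulrC eis_scale mem_reps.
      case/dvdnP: pN => M ->; rewrite mulnK // !PoszM => e; apply/eqP.
      by apply: (mulfI pn0); apply: (mulfI pn0); rewrite mulrA -expr2 e; ring.
  case Er: (filter _ _) => [|[x y] r] //.
  have : (x, y) \in filter (predI P1 P2) (reps (p * N)) by rewrite Er mem_head.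
  rewrite mem_filter mem_reps /P1 /P2 /= => /andP [/andP [h1 h2] /eqP e].
  have [/dvdzP [x' ex] /dvdzP [y' ey]] := key x y h1 h2.
  move: e; rewrite ex ey ![_ * p%:Z]mulrC eis_scale expr2 -mulrA PoszM => /(mulfI pn0) e.
  by move: pN; rewrite -[(p %| N)%N]/(p%:Z %| N%:Z)%Z -e dvdz_mulr.
have := count_predUI P1 P2 (reps (p * N)).
by rewrite P12 cP3 cP2 -cP1 mul2n -addnn.
Qed.

(** Strong induction, removing the least prime factor p. For chi(p) = 1 and chi(p) = -1 the
    recursion of [divsum_prime] is that of [size_reps_split] and [size_reps_inert]. The base N = 1
    lists the six units. *)
Lemma size_reps (N : nat) : (0 < N)%N -> ~~ (3 %| N)%N ->
  (size (reps N))%:Z = 6 * divsum chi N.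
Proof.
elim/ltn_ind: N => N IHN N0 N3.
have [N1|N1] := eqVneq N 1%N.
  by rewrite N1 /divsum; rewrite [divisors 1]/= big_seq1; vm_compute.
have N_gt1 : (1 < N)%N by lia.
have p_pr := pdiv_prime N_gt1; set p := pdiv N in p_pr.
have p_gt1 := prime_gt1 p_pr.
case/dvdnP: (pdiv_dvd N : p %| N)%N => M eN; rewrite mulnC in eN.
have M0 : (0 < M)%N by move: N0; rewrite eN muln_gt0 => /andP [].
have M3 : ~~ (3 %| M)%N by apply: contra N3; rewrite eN; apply: dvdn_mull.
have p3 : ~~ (3 %| p)%N by apply: contra N3; rewrite eN; apply: dvdn_mulr.
have ltMN : (M < N)%N by rewrite eN; nia.
have IHM := IHN M ltMN M0 M3.
have IHMp : (p %| M)%N -> (size (reps (M %/ p)))%:Z = 6 * divsum chi (M %/ p).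
  move=> pM; case/dvdnP: pM M0 M3 ltMN => K ->; rewrite mulnK ?(ltnW p_gt1) // => K0 K3 ltKN.
  apply: IHN; [by nia|by lia|].
  by apply: contra K3; apply: dvdn_mulr.
rewrite eN (divsum_prime p_pr M0 (chiM p)).
have p12 : (p %% 3 = 1 \/ p %% 3 = 2)%N by lia.
case: p12 => pm.
  have chip : chi p = 1 by rewrite /chi pm.
  have := size_reps_split p_pr pm M0; rewrite chip.
  by case: ifP => [/IHMp|_]; lia.
have chip : chi p = -1 by rewrite /chi pm.
by rewrite size_reps_inert // chip; case: ifP => [/IHMp|_]; lia.
Qed.

(** * 3-cores and the abacus *)

Local Open Scope nat_scope.

Lemma nth_geq_sorted s i j : sorted geq s -> i <= j -> j < size s -> nth 0 s j <= nth 0 s i.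
Proof.
move=> ss ij js.
have geq_tr : transitive geq by move=> a b c /= h1 h2; apply: leq_trans h1.
have geq_refl : reflexive geq by move=> a /=.
by apply: (sorted_leq_nth geq_tr geq_refl 0 ss) => //; rewrite inE //; lia.
Qed.

Lemma ltn_nth_conj s j k : sorted geq s -> k < size s ->
  (j < nth 0 s k) = (k < conj_part s j).
Proof.
rewrite /conj_part; elim: s k => [|x s IHs] k //= px ks.
have ss : sorted geq s by apply: path_sorted px.
case: (ltnP j x) => jx.
  by case: k ks => [|k] ks //=; rewrite IHs.
have h : all (fun y => y <= x) s.
  by apply: order_path_min px => a b c /= h1 h2; apply: leq_trans h1.
have -> : count (fun y => j < y) s = 0.
  apply/eqP; rewrite eqn0Ngt -has_count; apply/hasPn => y /(allP h) yx.
  by rewrite -leqNgt (leq_trans yx).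
rewrite addn0 ltn0; apply/negbTE; rewrite -leqNgt.
case: k ks => [|k] ks //=; apply: leq_trans jx.
by apply: (allP h); apply: mem_nth.
Qed.

Lemma conj_part_le_size s j : conj_part s j <= size s.
Proof. exact: count_size. Qed.

(* First-column hook lengths when no part is zero. *)
Definition beta (s : seq nat) : seq nat :=
  mkseq (fun k => nth 0 s k + (size s - k.+1)) (size s).

Lemma size_beta s : size (beta s) = size s.
Proof. exact: size_mkseq. Qed.

Lemma nth_beta s k : k < size s -> nth 0 (beta s) k = nth 0 s k + (size s - k.+1).
Proof. exact: nth_mkseq. Qed.

Lemma betaP s b :
  reflect (exists2 k, k < size s & b = nth 0 s k + (size s - k.+1)) (b \in beta s).
Proof.
apply: (iffP mapP) => [[k]|[k ks ->]]; first by rewrite mem_iota => /andP [_ ks] ->; exists k.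
by exists k; rewrite ?mem_iota.
Qed.

Lemma beta_gtn_sorted s : sorted geq s -> sorted gtn (beta s).
Proof.
move=> ss; apply/(sortedP 0) => k; rewrite size_beta => ks.
rewrite !nth_beta //=; last exact: ltnW.
by have := nth_geq_sorted ss (leqnSn k) ks; lia.
Qed.

(** On the abacus: no runner has a gap below a bead. *)
Definition closed3 (B : seq nat) := forall b, b \in B -> 3 <= b -> b - 3 \in B.

Lemma closed3_iter B b t : closed3 B -> b \in B -> 3 * t <= b -> b - 3 * t \in B.
Proof.
move=> cB bB; elim: t => [|t IHt] h; first by rewrite subn0.
have -> : b - 3 * t.+1 = b - 3 * t - 3 by lia.
by apply: cB; [apply: IHt; lia | lia].
Qed.

(** The hook lengths of row i are the distances from bead i to the gaps below it; with L = [size s],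
    column j gives the gap j + (L - lambda'_j). The converse is [gap_hook]. *)
Lemma hook_gap s i j : sorted geq s -> i < size s -> j < nth 0 s i ->
  exists2 c, c \notin beta s &
    hook s i j + c = nth 0 (beta s) i.
Proof.
move=> ss si ji; rewrite nth_beta //.
have := ji; rewrite (ltn_nth_conj _ ss si) => ci.
have cL := conj_part_le_size s j.
exists (j + (size s - conj_part s j)); last by rewrite /hook; lia.
apply/betaP => -[k ks]; have := ltn_nth_conj j ss ks.
by case: (ltnP k (conj_part s j)); lia.
Qed.

Lemma gap_hook s i c : sorted geq s -> i < size s -> c \notin beta s ->
  c < nth 0 (beta s) i ->
  exists2 j, j < nth 0 s i & hook s i j + c = nth 0 (beta s) i.
Proof.
move=> ss si cB ci.
have sb : sorted geq (beta s) by apply: sub_sorted (beta_gtn_sorted ss) => a b /= /ltnW.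
have sizeb := size_beta s.
set K := conj_part (beta s) c.
have KL : K <= size s by rewrite -sizeb; apply: conj_part_le_size.
have hK m : m < size s -> (c < nth 0 s m + (size s - m.+1)) = (m < K).
  by move=> ms; rewrite -nth_beta // ltn_nth_conj // sizeb.
have iK : i < K by rewrite -hK // -nth_beta.
have neq m : m < size s -> nth 0 s m + (size s - m.+1) != c.
  by move=> ms; apply: contraNneq cB => <-; apply/betaP; exists m.
have cKL : size s <= c + K.
  by case: (ltnP K (size s)) => h; [have := hK K h; have := neq K h; lia | lia].
(* Solves c = j + (L - lambda'_j) with lambda'_j = K, the number of beads above c; [cKL] keeps the
   subtraction from truncating. *)
pose j := c + K - size s.
have conjK : conj_part s j = K.
  have K1 : K.-1 < size s by lia.
  have h1 : K.-1 < conj_part s j.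
    by rewrite -(ltn_nth_conj _ ss K1); have := hK _ K1; rewrite /j; lia.
  have h2 : conj_part s j <= K.
    case: (ltnP K (size s)) => h; last by apply: leq_trans h; apply: conj_part_le_size.
    rewrite leqNgt -(ltn_nth_conj _ ss h).
    by have := hK K h; have := neq K h; rewrite /j; lia.
  by lia.
have ji : j < nth 0 s i by rewrite (ltn_nth_conj _ ss si) conjK.
exists j => //; rewrite nth_beta // /hook conjK.
by have := hK i si; rewrite /j; lia.
Qed.

(** A gap three below a bead is a hook of length 3. Conversely a hook of length 3 t is a gap 3 t
    below a bead, which [closed3_iter] forbids. *)
Lemma is_core3P s :
  reflect (sorted geq s /\ closed3 (beta s)) (is_core 3 s).
Proof.
apply: (iffP andP) => -[ss h]; split=> //.
  move=> b /(nthP 0) [i]; rewrite size_beta => si eb b3.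
  apply: contraT => cB.
  have ci : b - 3 < nth 0 (beta s) i by rewrite eb; lia.
  have [j ji hj] := gap_hook ss si cB ci.
  have := allP (allP h i _) j; rewrite !mem_iota /= !add0n => /(_ si ji).
  have -> : hook s i j = 3 by move: hj; rewrite eb; lia.
  by [].
apply/allP => i; rewrite mem_iota add0n => /= si; apply/allP => j; rewrite mem_iota add0n => /= ji.
have [c cB hc] := hook_gap ss si ji.
apply: contra cB => /dvdnP [t ht].
have -> : c = nth 0 (beta s) i - 3 * t by lia.
apply: closed3_iter => //; last by lia.
by apply: mem_nth; rewrite size_beta.
Qed.

Lemma beta_inj s1 s2 : size s1 = size s2 -> beta s1 = beta s2 -> s1 = s2.
Proof.
move=> e eb; apply: (eq_from_nth (x0 := 0)) => // k k1.
have := congr1 (fun b => nth 0 b k) eb; rewrite !nth_beta -?e //.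
by lia.
Qed.

(** Ensures that the subtraction in [unbeta] never truncates. *)
Lemma gtn_sorted_nth_ge B k : sorted gtn B -> k < size B -> size B - k.+1 <= nth 0 B k.
Proof.
elim: B k => [|x B IHB] //= [|k] px kB /=; last by rewrite subSS IHB // (path_sorted px).
case: B px IHB {kB} => [|y B] //= /andP [yx py] IHB.
by have := IHB 0 py isT; rewrite /=; lia.
Qed.

Definition unbeta (B : seq nat) : seq nat :=
  mkseq (fun k => nth 0 B k - (size B - k.+1)) (size B).

Lemma unbeta_sorted B : sorted gtn B -> sorted geq (unbeta B).
Proof.
move=> sB; apply/(sortedP 0) => k; rewrite size_mkseq => kB.
rewrite !nth_mkseq //=; last exact: ltnW.
by have /(sortedP 0) /(_ k kB) /= := sB; lia.
Qed.

Lemma unbetaK B : sorted gtn B -> beta (unbeta B) = B.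
Proof.
move=> sB; apply: (eq_from_nth (x0 := 0)); rewrite size_beta size_mkseq // => k kB.
rewrite nth_beta size_mkseq // nth_mkseq // subnK //.
exact: gtn_sorted_nth_ge.
Qed.

Lemma sumn_beta s : sumn (beta s) = sumn s + \sum_(k < size s) k.
Proof.
have iotaE : iota 0 (size s) = index_iota 0 (size s) by rewrite /index_iota subn0.
rewrite !sumnE /beta /mkseq big_map iotaE big_mkord big_split /=.
congr (_ + _); first by rewrite [RHS](big_nth 0) big_mkord.
by rewrite [RHS](reindex_inj rev_ord_inj).
Qed.

(** * Bead configurations on three runners *)

Definition bead_seq (r m : nat) : seq nat := [seq 3 * j + r | j <- iota 0 m].

(** Each runner is filled from the bottom; the order is decreasing, as in [beta]. *)
Definition beads (m0 m1 m2 : nat) : seq nat :=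
  sort geq (bead_seq 0 m0 ++ bead_seq 1 m1 ++ bead_seq 2 m2).

Lemma mem_bead_seq r m x : r < 3 -> (x \in bead_seq r m) = (x %% 3 == r) && (x %/ 3 < m).
Proof.
move=> r3; apply/mapP/andP => [[j]|[/eqP xr xm]].
  by rewrite mem_iota => hj ->; lia.
by exists (x %/ 3); [rewrite mem_iota | lia].
Qed.

Lemma mem_beads m0 m1 m2 x : x \in beads m0 m1 m2 =
  (x %/ 3 < (if x %% 3 == 0 then m0 else if x %% 3 == 1 then m1 else m2)).
Proof.
rewrite mem_sort !mem_cat !mem_bead_seq //.
have : x %% 3 < 3 by apply: ltn_pmod.
by case: (x %% 3) => [|[|[|?]]] //=; rewrite ?orbF.
Qed.

Lemma bead_seq_uniq r m : uniq (bead_seq r m).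
Proof. by rewrite map_inj_uniq ?iota_uniq // => i j; lia. Qed.

Lemma beads_uniq m0 m1 m2 : uniq (beads m0 m1 m2).
Proof.
rewrite sort_uniq !cat_uniq !bead_seq_uniq !andbT /=.
apply/andP; split; apply/hasPn => x; rewrite ?mem_cat !mem_bead_seq //; lia.
Qed.

Lemma geq_total : total geq. Proof. by move=> a b /=; apply: leq_total. Qed.

Lemma beads_sorted m0 m1 m2 : sorted gtn (beads m0 m1 m2).
Proof. by rewrite gtn_sorted_uniq_geq beads_uniq sort_sorted //; apply: geq_total. Qed.

Lemma size_beads m0 m1 m2 : size (beads m0 m1 m2) = m0 + m1 + m2.
Proof. by rewrite size_sort !size_cat !size_map !size_iota addnA. Qed.

Lemma beads_closed m0 m1 m2 : closed3 (beads m0 m1 m2).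
Proof.
move=> b; rewrite !mem_beads => h b3.
have -> : (b - 3) %% 3 = b %% 3 by lia.
by move: h; case: ifP => _; [|case: ifP => _]; lia.
Qed.

(** Doubled, with the negative term moved to the left, so as to avoid division and subtraction in
    [nat]. *)
Lemma sumn_bead_seq r m : 2 * sumn (bead_seq r m) + 3 * m = 2 * r * m + 3 * m * m.
Proof.
elim: m => [|m IHm]; first by rewrite /= !muln0.
have iotaE : iota 0 m.+1 = iota 0 m ++ [:: m] by rewrite -addn1 iotaD.
rewrite /bead_seq iotaE map_cat sumn_cat /= addn0 -/(bead_seq r m).
by nia.
Qed.

Lemma sumn_beads m0 m1 m2 : 2 * sumn (beads m0 m1 m2) + 3 * m0 + m1 =
  3 * (m0 * m0 + m1 * m1 + m2 * m2) + m2.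
Proof.
have -> : sumn (beads m0 m1 m2) =
    sumn (bead_seq 0 m0) + (sumn (bead_seq 1 m1) + sumn (bead_seq 2 m2)).
  by rewrite -!sumn_cat; apply: perm_sumn; rewrite perm_sort.
have := sumn_bead_seq 0 m0; have := sumn_bead_seq 1 m1; have := sumn_bead_seq 2 m2.
by lia.
Qed.

Definition runner (B : seq nat) (r : nat) : nat := count (fun x => x %% 3 == r) B.

Lemma down_closed_mem (w : seq nat) :
  uniq w -> (forall j, j.+1 \in w -> j \in w) -> w =i iota 0 (size w).
Proof.
move=> uw dw; have dle j i : j \in w -> i <= j -> i \in w.
  elim: j => [|j IHj]; first by rewrite leqn0 => h /eqP ->.
  by rewrite leq_eqVlt => h /orP [/eqP -> //|]; apply: IHj; apply: dw.
have sw : {subset w <= iota 0 (size w)}.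
  move=> j jw; rewrite mem_iota /= add0n -[j.+1](size_iota 0).
  apply: uniq_leq_size; first exact: iota_uniq.
  by move=> i; rewrite mem_iota => /= ij; apply: dle jw _.
have [_ h] := uniq_min_size uw sw (eq_leq (size_iota 0 (size w))).
by move=> j; rewrite h.
Qed.

Lemma runner_mem B r j : r < 3 -> uniq B -> closed3 B ->
  (3 * j + r \in B) = (j < runner B r).
Proof.
move=> r3 uB cB; pose w := [seq x %/ 3 | x <- B & x %% 3 == r].
have memw i : (i \in w) = (3 * i + r \in B).
  apply/mapP/idP => [[x]|h].
    by rewrite mem_filter => /andP [/eqP xr xB] ->; rewrite -xr mulnC -divn_eq.
  by exists (3 * i + r); [rewrite mem_filter h andbT; lia | lia].
have uw : uniq w.
  rewrite map_inj_in_uniq ?filter_uniq // => x y.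
  rewrite !mem_filter => /andP [/eqP xr _] /andP [/eqP yr _] e.
  by rewrite (divn_eq x 3) (divn_eq y 3) xr yr e.
have sw : size w = runner B r by rewrite size_map size_filter.
rewrite -memw down_closed_mem // ?sw ?mem_iota // => i; rewrite !memw => h.
have -> : 3 * i + r = 3 * i.+1 + r - 3 by lia.
by apply: cB => //; lia.
Qed.

Lemma closed3_beads B : sorted gtn B -> closed3 B ->
  B = beads (runner B 0) (runner B 1) (runner B 2).
Proof.
rewrite gtn_sorted_uniq_geq => /andP [uB sB] cB.
have := beads_sorted (runner B 0) (runner B 1) (runner B 2).
rewrite gtn_sorted_uniq_geq => /andP [uB' sB'].
apply: (sorted_eq _ _ sB sB').
- by move=> a b c /= h1 h2; apply: leq_trans h1.
- by move=> a b /= /andP [h1 h2]; apply/eqP; rewrite eqn_leq h1 h2.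
apply: uniq_perm => // x; rewrite mem_beads {1}(divn_eq x 3) mulnC runner_mem ?ltn_pmod //.
have : x %% 3 < 3 by apply: ltn_pmod.
by case: (x %% 3) => [|[|[|?]]].
Qed.

Lemma runner_beads m0 m1 m2 r : r < 3 ->
  runner (beads m0 m1 m2) r = (if r == 0 then m0 else if r == 1 then m1 else m2).
Proof.
move=> r3; set m := if _ then _ else _.
have h j : (j < runner (beads m0 m1 m2) r) = (j < m).
  rewrite -runner_mem ?beads_uniq //; last exact: beads_closed.
  rewrite mem_beads /m.
  have -> : (3 * j + r) %% 3 = r by lia.
  by have -> : (3 * j + r) %/ 3 = j by lia.
have := h m; have := h (runner (beads m0 m1 m2) r); rewrite !ltnn => /esym h1 h2.
by apply/eqP; case: ltngtP h1 h2.
Qed.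

Lemma double_sum_ord n : 2 * (\sum_(k < n) k) + n = n * n.
Proof.
elim: n => [|n IHn]; first by rewrite big_ord0.
rewrite big_ord_recr /=; move: (\sum_(k < n) _) IHn => S; lia.
Qed.

(** Equates two evaluations of the sum of the beads, [sumn_beta] and [sumn_beads]. *)
Lemma core3_weight s (m := runner (beta s)) : is_core 3 s ->
  m 0 + m 1 + m 2 = size s /\
  2 * sumn s + size s * size s + 3 * m 0 + m 1 =
  3 * (m 0 * m 0 + m 1 * m 1 + m 2 * m 2) + m 2 + size s.
Proof.
case/is_core3P=> ss cB; have eB := closed3_beads (beta_gtn_sorted ss) cB.
have := sumn_beads (m 0) (m 1) (m 2); have := size_beads (m 0) (m 1) (m 2).
rewrite -eB size_beta sumn_beta => e h; split=> //.
move: (double_sum_ord (size s)) h; move: (\sum_(k < size s) _) => S.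
by lia.
Qed.

Lemma unbeta_beads_core m0 m1 m2 : is_core 3 (unbeta (beads m0 m1 m2)).
Proof.
apply/is_core3P; rewrite unbetaK ?beads_sorted //; split; last exact: beads_closed.
exact: unbeta_sorted (beads_sorted _ _ _).
Qed.

Lemma core3_inj s1 s2 : is_core 3 s1 -> is_core 3 s2 -> size s1 = size s2 ->
  runner (beta s1) 1 = runner (beta s2) 1 -> runner (beta s1) 2 = runner (beta s2) 2 ->
  s1 = s2.
Proof.
move=> c1 c2 e12 e1 e2; apply: beta_inj => //.
have [h1 _] := core3_weight c1; have [h2 _] := core3_weight c2.
have e0 : runner (beta s1) 0 = runner (beta s2) 0 by lia.
case/is_core3P: c1 => ss1 cB1; case/is_core3P: c2 => ss2 cB2.
rewrite (closed3_beads (beta_gtn_sorted ss1) cB1) (closed3_beads (beta_gtn_sorted ss2) cB2).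
by rewrite e0 e1 e2.
Qed.

Local Open Scope ring_scope.

(* Any integral bead vector of weight at most n comes from an actual abacus: a negative
   m_r would force more than n parts. *)
Lemma weight_nonneg (n i m0 m1 m2 : int) :
  n = m0 + m1 + m2 -> i <= n ->
  2 * i + n * n + 3 * m0 + m1 = 3 * (m0 * m0 + m1 * m1 + m2 * m2) + m2 + n ->
  [/\ 0 <= m0, 0 <= m1 & 0 <= m2].
Proof.
move=> -> hi e; split; rewrite leNgt; apply/negP => neg.
(* With p = m1 - m0 and q = m2 - m0 the hypotheses give 3 m0 >= p^2 - p q + q^2 - p. Completing
   squares shows that the right side exceeds -3, so m0 > -1. The other two cases are similar, with
   other linear terms. *)
- have := sqr_ge0 (2 * (m2 - m0) - (m1 - m0)); have := sqr_ge0 (m1 - m0).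
  by have := sqr_ge0 (m1 - m0 - 1); nia.
- have := sqr_ge0 (2 * (m2 - m1) - (m0 - m1)); have := sqr_ge0 (m0 - m1 - 2).
  by have := sqr_ge0 (m0 - m1 - 1); have := sqr_ge0 (2 * (m0 - m1) - (m2 - m1) - 2); nia.
- have := sqr_ge0 (2 * (m0 - m2) - (m1 - m2) - 2).
  by have := sqr_ge0 (m1 - m2 - 1); nia.
Qed.

(** Padding to n parts puts n beads on the abacus. Eliminating m_0 from the weight equation and
    completing the form turns it into eis(x, y) = 3 i + 1, while n fixes x and y mod 3. Surjectivity
    rests on [weight_nonneg]. *)
Lemma card_cores (n i : nat) : (i <= n)%N ->
  #|[set t : n.-tuple 'I_n.+1 | is_core 3 (map val (val t)) && (sumn (map val (val t)) == i)]| =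
  size [seq z <- reps (3 * i + 1) | (3 %| z.1 - (n%:Z - 1))%Z && (3 %| z.2 - n%:Z)%Z].
Proof.
move=> le_in; rewrite cardE.
pose parts (t : n.-tuple 'I_n.+1) : seq nat := map val (val t).
have size_parts t : size (parts t) = n by rewrite size_map size_tuple.
have in_cores t : (t \in enum [set t : n.-tuple 'I_n.+1 |
      is_core 3 (map val (val t)) && (sumn (map val (val t)) == i)]) =
    is_core 3 (parts t) && (sumn (parts t) == i) by rewrite mem_enum inE.
(* With m_r beads on runner r: (x, y) = (n - 1 - 3 m_2, n - 3 m_1), m_0 + m_1 + m_2 = n. *)
pose f (t : n.-tuple 'I_n.+1) : int * int :=
  (n%:Z - 1 - 3 * (runner (beta (parts t)) 2)%:Z, n%:Z - 3 * (runner (beta (parts t)) 1)%:Z).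
apply: (size_bij (f := f)).
- exact: enum_uniq.
- exact: filter_uniq (reps_uniq _).
- move=> t1 t2; rewrite !in_cores => /andP [c1 _] /andP [c2 _] [e1 e2].
  apply: val_inj; apply: (inj_map val_inj).
  by apply: (core3_inj c1 c2); rewrite ?size_parts //; lia.
- move=> t; rewrite in_cores => /andP [ct /eqP st].
  rewrite mem_filter mem_reps /f /=.
  have [h1 h2] := core3_weight ct; rewrite size_parts st in h1 h2.
  move: h1 h2; move: (runner _ 0) (runner _ 1) (runner _ 2) => m0 m1 m2 h1 h2.
  apply/andP; split; first by lia.
  by rewrite /eis /=; apply/eqP; nia.
- move=> [x y]; rewrite mem_filter mem_reps /= => /andP [/andP [/dvdzP [c ec] /dvdzP [b eb]] /eqP e].
  pose m1 := - b; pose m2 := - c; pose m0 := n%:Z - m1 - m2.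
  have ex : x = n%:Z - 1 - 3 * m2 by rewrite /m2; lia.
  have ey : y = n%:Z - 3 * m1 by rewrite /m1; lia.
  have em : n%:Z = m0 + m1 + m2 by rewrite /m0; ring.
  have ew : 2 * i%:Z + n%:Z * n%:Z + 3 * m0 + m1 =
      3 * (m0 * m0 + m1 * m1 + m2 * m2) + m2 + n%:Z.
    by move: e; rewrite /eis /= ex ey; move: (m0) em => k em; nia.
  have [p0 p1 p2] := weight_nonneg em (le_in : i%:Z <= n%:Z) ew.
  move: (m0) (m1) (m2) p0 p1 p2 ex ey em ew => [k0|//] [k1|//] [k2|//] _ _ _ ex ey em ew.
  have ek : (k0 + k1 + k2)%N = n by lia.
  pose s := unbeta (beads k0 k1 k2).
  have cs : is_core 3 s by apply: unbeta_beads_core.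
  have bs : beta s = beads k0 k1 k2 by rewrite unbetaK ?beads_sorted.
  have ss : size s = n by rewrite size_mkseq size_beads.
  have sums : sumn s = i.
    by have [_] := core3_weight cs; rewrite bs ss !runner_beads //=; lia.
  have size_s : size (map (@inord n) s) == n by rewrite size_map ss.
  have part_s : parts (Tuple size_s) = s.
    rewrite /parts /= -map_comp; apply: map_id_in => a a_s /=; rewrite inordK // ltnS.
    (* A part is at most the total i <= n, so [inord] leaves it unchanged. *)
    apply: leq_trans le_in; rewrite -sums sumnE (big_rem _ a_s) /=; exact: leq_addr.
  exists (Tuple size_s); first by rewrite in_cores part_s cs sums eqxx.
  by rewrite /f part_s bs !runner_beads //= ex ey.
Qed.

(** * The formula for A_3 *)

Definition eis_class (a b : int) (t : int * int) : bool :=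
  (3 %| t.1 - a)%Z && (3 %| t.2 - b)%Z.

(** Multiplication by the unit zeta: (x, y) -> (-y, x + y). *)
Lemma count_eis_rot (N : nat) (a b : int) :
  count (eis_class a b) (reps N) = count (eis_class (- b) (a + b)) (reps N).
Proof.
apply: (count_bij (f := fun t : int * int => (- t.2, t.1 + t.2))
  (g := fun t : int * int => (t.1 + t.2, - t.1))); try exact: reps_uniq.
all: move=> [x y]; rewrite (mem_reps N (x, y)) /eis_class /= => /eqP e h; split;
  [ | by lia | by congr (_, _); ring].
all: by rewrite mem_reps -e /eis /=; apply/eqP; ring.
Qed.

Lemma size_reps_class (N n : nat) : (N %% 3 = 1)%N ->
  size (reps N) = (6 * count (eis_class (n%:Z - 1) n%:Z) (reps N))%N.
Proof.
move=> N1; set a := n%:Z - 1; set b := n%:Z.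
pose rot (ab : int * int) := (- ab.2, ab.1 + ab.2).
pose orbit := traject rot (a, b) 6.
have orbitE ab : ab \in orbit ->
    count (eis_class ab.1 ab.2) (reps N) = count (eis_class a b) (reps N).
  case/trajectP=> k _ ->; elim: k => [|k IHk] //.
  by rewrite -IHk iterS; case: (iter k rot (a, b)) => u v; rewrite [RHS]count_eis_rot.
have eqF (u v : int) : (3 %| u - v)%Z = (u%:~R == v%:~R :> 'F_3).
  by rewrite (dvdz_pcharf (pchar_Fp (isT : prime 3))) rmorphB subr_eq0.
(* The orbit meets each of the six classes with x and y incongruent mod 3 exactly once, by
   enumeration over F_3. *)
have orbit1 x y : ~~ (3 %| x - y)%Z ->
    (\sum_(ab <- orbit) eis_class ab.1 ab.2 (x, y) = 1)%N.
  rewrite /orbit /rot /eis_class /a /b /= !big_cons big_nil /= !eqF.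
  rewrite !(rmorphD, rmorphN, rmorph1) /=.
  move: (x%:~R : 'F_3) (y%:~R : 'F_3) (n%:Z%:~R : 'F_3).
  by do 3 case=> [[|[|[|//]]] ?].
transitivity (\sum_(ab <- orbit) count (eis_class ab.1 ab.2) (reps N))%N.
  (* If x = y mod 3 then 3 divides the norm, contrary to N = 1 mod 3. *)
  have : forall t, t \in reps N -> ~~ (3 %| t.1 - t.2)%Z.
    move=> [x y]; rewrite mem_reps /= => /eqP e; apply/negP => /dvdzP [k ek].
    have ex : x = y + k * 3 by rewrite -ek; ring.
    by move: e; rewrite ex /eis /=; lia.
  elim: (reps N) => [|[x y] s IHs] ht; first by rewrite big1.
  rewrite /= big_split /= orbit1; last exact: (ht _ (mem_head _ _)).
  by rewrite -IHs // => t ts; apply: ht; rewrite inE ts orbT.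
rewrite (eq_big_seq _ orbitE) big_const_seq count_predT size_traject.
by rewrite iter_addn_0 mulnC.
Qed.

Lemma card_cores_divsum (n i : nat) : (i <= n)%N ->
  #|[set t : n.-tuple 'I_n.+1 |
     is_core 3 (map val (val t)) && (sumn (map val (val t)) == i)]|%:Z =
  divsum chi (3 * i + 1).
Proof.
move=> le_in; rewrite card_cores // size_filter.
have N3 : ~~ (3 %| 3 * i + 1)%N by lia.
have N1 : ((3 * i + 1) %% 3 = 1)%N by lia.
have N0 : (0 < 3 * i + 1)%N by lia.
have := size_reps_class n N1; have := size_reps N0 N3.
rewrite -[count _ _]/(count (eis_class (n%:Z - 1) n%:Z) (reps (3 * i + 1))).
by lia.
Qed.

(** The form is (x - y)^2 mod 3, never 2, so N has no representations and [size_reps] gives the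
    value 0. *)
Lemma divsum_chi_eq0 (N : nat) : (N %% 3 = 2)%N -> divsum chi N = 0.
Proof.
move=> N2; have N3 : ~~ (3 %| N)%N by lia.
have N0 : (0 < N)%N by lia.
have := size_reps N0 N3.
case Er : (reps N) => [|[x y] r] /=; first by lia.
have : (x, y) \in reps N by rewrite Er mem_head.
rewrite mem_reps /eis /= => /eqP e.
have e4 : (x - y) ^+ 2 = N%:Z - 3 * (x * y) by rewrite -e; ring.
have [k [hk|[hk|hk]]] : exists k, x - y = 3 * k \/ x - y = 3 * k + 1 \/ x - y = 3 * k - 1.
  by exists ((x - y + 1) %/ 3)%Z; lia.
all: by move: e4; rewrite hk; lia.
Qed.

Lemma sum_residue1 (F : nat -> int) (n : nat) :
  (forall j, (j < 3 * n + 2)%N -> (j %% 3 != 1)%N -> F j = 0) ->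
  \sum_(1 <= j < 3 * n + 2) F j = \sum_(i < n.+1) F (3 * i + 1)%N.
Proof.
elim: n => [|n IHn] F0; first by rewrite big_nat1 big_ord_recr big_ord0 /= add0r.
have eM : (3 * n.+1 + 2 = (3 * n + 2).+3)%N by lia.
rewrite eM in F0 *.
rewrite !big_nat_recr //=; try lia.
rewrite IHn => [|j hj j1]; last by apply: F0 => //; lia.
rewrite [RHS]big_ord_recr /= (F0 (3 * n + 2)%N) 1?(F0 (3 * n + 2).+1); try lia.
rewrite !addr0; congr (_ + F _); lia.
Qed.

Lemma A3_conv (n : nat) : (A3 n)%:Z =
  \sum_(i < n.+1) divsum chi (3 * i + 1) * divsum chi (3 * (n - i) + 1).
Proof.
pose c (i : nat) := [set t : n.-tuple 'I_n.+1 |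
     is_core 3 (map val (val t)) && (sumn (map val (val t)) == i)].
have -> : A3 n = (\sum_(i < n.+1) #|c i| * #|c (n - i)|)%N.
  (* Fibre over the size of the first core; it is at most n, so [inord] does not change it. *)
  rewrite /A3; pose g (x : n.-tuple 'I_n.+1 * n.-tuple 'I_n.+1) : 'I_n.+1 :=
    inord (sumn (map val (val x.1))).
  rewrite -sum1_card (partition_big g predT) //=.
  apply: eq_bigr => i _; rewrite sum1_card -cardsX; apply: eq_card => -[t1 t2].
  rewrite [LHS]unfold_in /= !inE /g /=.
  have hi := ltn_ord i.
  apply/andP/andP => [[/and3P [c1 c2 /eqP e] /eqP ei]|[/andP [c1 /eqP e1] /andP [c2 /eqP e2]]].
    rewrite c1 c2 /=.
    have es : sumn (map val (val t1)) = i.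
      by rewrite -ei inordK // ltnS; apply: leq_trans (leq_addr _ _) (eq_leq e).
    rewrite es eqxx; split=> //; move: e; rewrite es.
    by move: (sumn _) => b eb; apply/eqP; lia.
  rewrite c1 c2 e1 e2 /=; split; first by apply/eqP; lia.
  by rewrite inord_val.
rewrite -[LHS]natz natr_sum; apply: eq_bigr => i _.
have hi := ltn_ord i.
by rewrite natz PoszM !card_cores_divsum //; lia.
Qed.

(** * The divisor function and the conclusion *)

Definition sigma (N : nat) : int := divsum (fun d => d%:R) N.

(** In the convolution for M = 3 n + 2 only j = 1 mod 3 survives: otherwise j or M - j is 2 mod 3
    and its factor vanishes. *)
Lemma A3_sigma (n : nat) : 3 * (A3 n)%:Z = sigma (3 * n + 2).
Proof.
have M2 : ((3 * n + 2) %% 3 = 2)%N by lia.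
rewrite A3_conv -[RHS](divsum_chi_conv M2 (divsum_chi_eq0 M2)); congr (_ * _).
pose F j := divsum chi j * divsum chi (3 * n + 2 - j).
have F0 j : (j < 3 * n + 2)%N -> (j %% 3 != 1)%N -> F j = 0.
  rewrite /F => hj j1; have [h|h] : (j %% 3 = 2)%N \/ (j %% 3 = 0)%N by lia.
    by rewrite divsum_chi_eq0 ?mul0r.
  by rewrite (@divsum_chi_eq0 (3 * n + 2 - j)) ?mulr0 //; lia.
rewrite -[RHS]/(\sum_(1 <= j < 3 * n + 2) F j) (sum_residue1 F0).
apply: eq_bigr => i _; rewrite /F; congr (_ * divsum _ _).
by have := ltn_ord i; lia.
Qed.

Lemma sigma_pfactor (p k m : nat) : prime p -> ~~ (p %| m)%N ->
  sigma (p ^ k * m) * (p%:Z - 1) = (p%:Z ^+ k.+1 - 1) * sigma m.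
Proof.
move=> p_pr pm; have p0 := prime_gt0 p_pr.
have m0 : (0 < m)%N by case: m pm => //; rewrite dvdn0.
have rec N : (0 < N)%N -> sigma (p * N) =
    (1 + p%:Z) * sigma N - p%:Z * (if (p %| N)%N then sigma (N %/ p) else 0).
  move=> N0; by rewrite /sigma divsum_prime // => [|a]; rewrite ?natrM ?natz.
have pk0 j : (0 < p ^ j * m)%N by rewrite muln_gt0 expn_gt0 p0.
(* The recursion has order two, so two consecutive exponents are carried through the induction. *)
suff [//] : sigma (p ^ k * m) * (p%:Z - 1) = (p%:Z ^+ k.+1 - 1) * sigma m /\
  sigma (p ^ k.+1 * m) * (p%:Z - 1) = (p%:Z ^+ k.+2 - 1) * sigma m.
elim: k => [|k [IH1 IH2]].
  rewrite expn1 mul1n rec // (negPf pm); split; ring.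
split=> //; rewrite [in LHS]expnS -mulnA rec //.
have -> : (p %| p ^ k.+1 * m)%N by rewrite expnS -mulnA dvdn_mulr.
have -> : (p ^ k.+1 * m %/ p = p ^ k * m)%N by rewrite expnS -mulnA mulKn.
rewrite mulrBl -!mulrA IH1 IH2 !exprS; ring.
Qed.

(** Common form of both claims: p^k = 1 mod 3 makes the division by 3 in the index exact. *)
Lemma A3_pfactor (p k n : nat) : prime p -> ~~ (p %| 3 * n + 2)%N ->
  (p ^ k %% 3 = 1)%N ->
  A3 (p ^ k * n + (2 * p ^ k - 2) %/ 3) = ((p ^ k.+1 - 1) %/ (p - 1) * A3 n)%N.
Proof.
move=> p_pr pn pk; have p1 := prime_gt1 p_pr.
have /dvdnP [Q eQ] : (p - 1 %| p ^ k.+1 - 1)%N.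
  by rewrite !subn1 predn_exp dvdn_mulr.
rewrite eQ mulnK; last by lia.
have idx : (3 * (p ^ k * n + (2 * p ^ k - 2) %/ 3) + 2 = p ^ k * (3 * n + 2))%N.
  by move: (p ^ k)%N pk => K; lia.
have := sigma_pfactor k p_pr pn; rewrite -idx -!A3_sigma.
have -> : p%:Z ^+ k.+1 - 1 = Q%:Z * (p%:Z - 1).
  have -> : p%:Z ^+ k.+1 = (p ^ k.+1)%N%:Z by rewrite -!natz natrX.
  have : (0 < p ^ k.+1)%N by rewrite expn_gt0 ltnW.
  by move: (p ^ k.+1)%N eQ => K; lia.
move: (A3 _) (A3 n) => x y e.
have pz : p%:Z - 1 != 0 by lia.
suff : x%:Z = Q%:Z * y%:Z by lia.
have z3 : (3 : int) != 0 by [].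
by apply: (mulfI z3); apply: (mulIf pz); rewrite e; ring.
Qed.

Local Open Scope nat_scope.

Theorem theorem2p4 (p k n : nat) :
  prime p -> ~~ (p %| 3 * n + 2) ->
  (p %% 3 = 1 ->
     A3 (p ^ k * n + (2 * p ^ k - 2) %/ 3) = (p ^ k.+1 - 1) %/ (p - 1) * A3 n) /\
  (p %% 3 = 2 ->
     A3 (p ^ (2 * k) * n + (2 * p ^ (2 * k) - 2) %/ 3)
       = (p ^ (2 * k).+1 - 1) %/ (p - 1) * A3 n).
Proof.
move=> p_pr pn; split=> p3; apply: A3_pfactor => //.
  by rewrite -modnXm p3 exp1n.
have p2 : p ^ 2 %% 3 = 1 by rewrite -modnXm p3.
by rewrite expnM -modnXm p2 exp1n.
Qed.
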